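(* For every hypergraph $H$, the following holds. (a) $\tau(H) \le \tau_g(H) \le 2\tau(H)-1$. (b) $\tau(H) \le \tau_g'(H) \le 2\tau(H)$.
   Context: A hypergraph $H=(V(H),E(H))$ is a finite set $V(H)$ of vertices together with a finite multiset $E(H)$ of nonempty subsets of $V(H)$, called edges. A vertex hits an edge if it belongs to that edge; a transversal is a set of vertices having nonempty intersection with every edge, and the transversal number $\tau(H)$ is the minimum size of a transversal of $H$. The transversal game on $H$ is played by two players, Edge-hitter and Staller, who take turns choosing a vertex of $H$; each chosen vertex must hit at least one edge not hit by the vertices previously chosen. The game ends when the set of chosen vertices is a transversal of $H$. Edge-hitter wishes to minimize, and Staller wishes to maximize, the total number of vertices chosen. $\tau_g(H)$ (resp. $\tau_g'(H)$) is the total number of vertices chosen when Edge-hitter (resp. Staller) moves first and both players play optimally.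
   Formalization: For a hypergraph with no edges, τ(H) = τ_g(H) = 0 and the upper bound 2τ(H)−1 = −1 in (a) fails; the formal statement reads 2τ(H)−1 as 0 in that case and is the stated bound for every hypergraph with at least one edge. *)

(* Defs.v *)
From mathcomp Require Import all_boot.
From mathcomp Require Import finmap multiset.

Set Implicit Arguments.
Unset Strict Implicit.
Unset Printing Implicit Defensive.

Local Open Scope mset_scope.
Local Open Scope nat_scope.

Record hypergraph := Hypergraph {
  vertex : finType;
  edges : {mset {set vertex}};
  edges_nonempty : set0 \notin edges
}.

Definition transversal (H : hypergraph) (S : {set vertex H}) : bool :=
  [forall e : {set vertex H}, (e \in edges H) ==> (S :&: e != set0)].

(* [setT] is a transversal because edges are nonempty (lemma [transversalT]),
   so the [arg min] is a genuine minimum. *)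
Definition tau (H : hypergraph) : nat :=
  #|[arg min_(S < [set: vertex H] | transversal S) #|S|]|.

Variant player := EdgeHitter | Staller.

Definition opponent (p : player) : player :=
  if p is EdgeHitter then Staller else EdgeHitter.

(* [S] is the set of vertices chosen so far. *)
Definition legal (H : hypergraph) (S : {set vertex H}) (v : vertex H) : bool :=
  [exists e : {set vertex H},
     [&& e \in edges H, v \in e & S :&: e == set0]].

(* Number of further vertices chosen under optimal play from position [S] with
   [p] to move, cut off at [n] moves. As the recursive values are at most [n],
   the default [n] of the minimum never affects a minimum over a nonempty set
   of moves. *)
Fixpoint moves_upto (n : nat) (H : hypergraph) (p : player)
    (S : {set vertex H}) : nat :=
  if n is n'.+1 then
    if transversal S then 0
    else if p is EdgeHitter then
      (\big[minn/n']_(v | legal S v) moves_upto n' Staller (v |: S)).+1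
    else
      (\max_(v | legal S v) moves_upto n' EdgeHitter (v |: S)).+1
  else 0.

(* A legal move is never an already chosen vertex, so #|~: S| moves suffice to
   finish the game; [moves_end], [moves_EdgeHitter] and [moves_Staller] below
   are the backward-induction equations, without any bound. *)
Definition moves (H : hypergraph) (p : player) (S : {set vertex H}) : nat :=
  moves_upto #|~: S| p S.

Definition tau_g (H : hypergraph) : nat := moves EdgeHitter (@set0 (vertex H)).

Definition tau_g' (H : hypergraph) : nat := moves Staller (@set0 (vertex H)).

Lemma transversalT (H : hypergraph) : transversal [set: vertex H].
Proof.
apply/forallP => e; apply/implyP => eE; rewrite setTI.
by apply: contraNneq (edges_nonempty H) => <-.
Qed.

Lemma legal_notin (H : hypergraph) (S : {set vertex H}) (v : vertex H) :
  legal S v -> v \notin S.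
Proof.
case/existsP => e /and3P[_ ve /eqP Se0]; apply/negP => vS.
by have: v \in S :&: e by [rewrite inE vS ve]; rewrite Se0 inE.
Qed.

Lemma legal_exists (H : hypergraph) (S : {set vertex H}) :
  ~~ transversal S -> exists v, legal S v.
Proof.
case/forallPn => e; rewrite negb_imply negbK => /andP[eE Se0].
have /set0Pn[v ve] : e != set0.
  by apply: contraNneq (edges_nonempty H) => <-.
by exists v; apply/existsP; exists e; rewrite eE ve Se0.
Qed.

Lemma legal_card (H : hypergraph) (S : {set vertex H}) (v : vertex H) :
  legal S v -> #|~: S| = #|~: (v |: S)|.+1.
Proof.
move=> /legal_notin vS; rewrite (cardsD1 v) inE vS; congr _.+1.
by apply: eq_card => x; rewrite !inE negb_or.
Qed.

Lemma moves_upto_le (n : nat) (H : hypergraph) (p : player)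
  (S : {set vertex H}) : moves_upto n p S <= n.
Proof.
elim: n p S => [//|n IHn] p S /=; case: ifP => // _; case: p; rewrite ltnS.
  by elim/big_rec: _ => // v x _ xn; rewrite geq_min IHn.
by apply/bigmax_leqP.
Qed.

Lemma moves_end (H : hypergraph) (p : player) (S : {set vertex H}) :
  transversal S -> moves p S = 0.
Proof. by rewrite /moves; case: #|_| => //= n ->. Qed.

Lemma moves_EdgeHitter (H : hypergraph) (S : {set vertex H}) :
  ~~ transversal S ->
  (exists2 v, legal S v & moves EdgeHitter S = (moves Staller (v |: S)).+1) /\
  (forall v, legal S v -> moves EdgeHitter S <= (moves Staller (v |: S)).+1).
Proof.
move=> nT; have [v0 v0S] := legal_exists nT; pose n := #|~: (v0 |: S)|.
have cardE v : legal S v -> #|~: (v |: S)| = n.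
  by move=> vS; apply: succn_inj; rewrite -(legal_card vS) (legal_card v0S).
pose F v := moves_upto n Staller (v |: S).
have movesE : moves EdgeHitter S = (\big[minn/n]_(v | legal S v) F v).+1.
  by rewrite /moves (legal_card v0S) /= (negPf nT).
have FE v : legal S v -> moves Staller (v |: S) = F v.
  by move=> vS; rewrite /moves cardE.
pose w := [arg min_(v < v0 | legal S v) F v].
have [wS wmin] : legal S w /\ forall v, legal S v -> F w <= F v.
  by rewrite /w; case: arg_minnP.
have minle v : legal S v -> \big[minn/n]_(v | legal S v) F v <= F v.
  move=> vS; elim: (index_enum _) (mem_index_enum v) => // u r IHr.
  rewrite inE big_cons => /predU1P[<-|/IHr ur]; first by rewrite vS geq_minl.
  by case: ifP => // _; rewrite geq_min ur orbT.
split; last by move=> v vS; rewrite movesE FE // ltnS minle.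
exists w => //; rewrite movesE FE //; congr _.+1.
apply/eqP; rewrite eqn_leq minle //=.
elim/big_rec: _ => [|v x vS wx]; first exact: moves_upto_le.
by rewrite leq_min wmin.
Qed.

Lemma moves_Staller (H : hypergraph) (S : {set vertex H}) :
  ~~ transversal S ->
  (exists2 v, legal S v & moves Staller S = (moves EdgeHitter (v |: S)).+1) /\
  (forall v, legal S v -> (moves EdgeHitter (v |: S)).+1 <= moves Staller S).
Proof.
move=> nT; have [v0 v0S] := legal_exists nT; pose n := #|~: (v0 |: S)|.
have cardE v : legal S v -> #|~: (v |: S)| = n.
  by move=> vS; apply: succn_inj; rewrite -(legal_card vS) (legal_card v0S).
pose F v := moves_upto n EdgeHitter (v |: S).
have movesE : moves Staller S = (\max_(v | legal S v) F v).+1.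
  by rewrite /moves (legal_card v0S) /= (negPf nT).
have FE v : legal S v -> moves EdgeHitter (v |: S) = F v.
  by move=> vS; rewrite /moves cardE.
have maxge v : legal S v -> F v <= \max_(v | legal S v) F v.
  by move=> vS; rewrite (bigD1 v) //= leq_maxl.
split; last by move=> v vS; rewrite movesE FE // ltnS maxge.
have [|w wS wE] := @eq_bigmax_cond _ (legal S) F.
  by apply/card_gt0P; exists v0.
by exists w => //; rewrite movesE FE // -wE.
Qed.

(* Main.v *)
Require Import Defs.
From mathcomp Require Import all_boot.

(** The lower bounds hold because the vertices chosen in any complete play form
    a transversal: from a position [S], the set [S] together with the vertices
    still to be chosen form a transversal, whoever moves next
    ([tau_le_card_moves]).

    For the upper bounds, Edge-hitter fixes a minimum transversal [R] and always
    chooses a vertex of [R] that hits an edge not hit so far.  Such a vertex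
    exists as long as the game is not over, since [R] meets every edge
    ([completion_legal]), and once it is chosen it can be dropped from [R].
    Edge-hitter thus makes at most [#|R|] moves.  Once [R] is exhausted the game
    is over, so Staller moves at most [#|R| - 1] times when Edge-hitter starts
    and at most [#|R|] times when Staller starts ([moves_le_double]).
    The induction runs over arbitrary positions [S], with [R] any set that
    completes [S] to a transversal. *)

(* The unqualified name otherwise denotes transversals of set partitions. *)
Local Notation transversal := Defs.transversal.

Lemma tau_le_card {H : hypergraph} (S : {set vertex H}) :
  transversal S -> tau H <= #|S|.
Proof.
by move=> tS; rewrite /tau; case: arg_minnP => [|T _]; [apply: transversalT | apply].
Qed.

Lemma tau_attained (H : hypergraph) :
  exists2 R : {set vertex H}, transversal R & #|R| = tau H.
Proof.
rewrite /tau; case: arg_minnP => [|R tR _]; first exact: transversalT.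
by exists R.
Qed.

Lemma transversalS {H : hypergraph} {S T : {set vertex H}} :
  S \subset T -> transversal S -> transversal T.
Proof.
move=> ST /forallP tS; apply/forallP => e; apply/implyP => eE.
have /set0Pn[v] := implyP (tS e) eE; rewrite inE => /andP[vS ve].
by apply/set0Pn; exists v; rewrite inE (subsetP ST) // ve.
Qed.

(** Some edge is not hit by [S], so it must be hit by the completion [R]. *)
Lemma completion_legal {H : hypergraph} {R S : {set vertex H}} :
  transversal (R :|: S) -> ~~ transversal S -> exists2 v, v \in R & legal S v.
Proof.
move=> /forallP tRS /forallPn[e]; rewrite negb_imply negbK => /andP[eE Se0].
have /set0Pn[v] := implyP (tRS e) eE; rewrite !inE => /andP[vRS ve].
have vS : v \notin S.
  apply/negP => vS; have : v \in S :&: e by rewrite inE vS ve.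
  by rewrite (eqP Se0) inE.
exists v; first by rewrite (negPf vS) orbF in vRS.
by apply/existsP; exists e; rewrite eE ve Se0.
Qed.

(** When the game is over the chosen set is itself a transversal, and each move
    before that adds one chosen vertex and uses up one of the remaining moves,
    so the sum on the right is unchanged along an optimal play. *)
Lemma tau_le_card_moves (H : hypergraph) (p : player) (S : {set vertex H}) :
  tau H <= #|S| + moves p S.
Proof.
have [n] := ubnP #|~: S|; elim: n => // n IHn in p S *; rewrite ltnS => Sn.
have [tS|ntS] := boolP (transversal S).
  by rewrite moves_end // addn0 tau_le_card.
have step q v : legal S v -> tau H <= #|S| + (moves q (v |: S)).+1.
  move=> lv; rewrite addnS -addSn -add1n.
  have <- : #|v |: S| = 1 + #|S| by rewrite cardsU1 (legal_notin lv).
  by apply: IHn; rewrite -(legal_card lv).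
case: p.
  by have [[v lv ->] _] := moves_EdgeHitter ntS; apply: step.
by have [[v lv ->] _] := moves_Staller ntS; apply: step.
Qed.

(** A Staller move keeps [R] as the completion and hands the turn to
    Edge-hitter, whose bound is smaller by one; an Edge-hitter move inside [R]
    shrinks the completion by one vertex. The first bound is therefore proved
    from the second for a smaller [R], and the second from the first for the
    same [R]. *)
Lemma moves_le_double (H : hypergraph) (R S : {set vertex H}) :
  transversal (R :|: S) ->
  moves EdgeHitter S <= 2 * #|R| - 1 /\ moves Staller S <= 2 * #|R|.
Proof.
have [n] := ubnP #|R|; elim: n => // n IHn in R S *; rewrite ltnS => Rn tRS.
have EdgeHitter_le T :
    transversal (R :|: T) -> moves EdgeHitter T <= 2 * #|R| - 1.
  move=> tRT; have [tT|ntT] := boolP (transversal T); first by rewrite moves_end.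
  have [v vR lv] := completion_legal tRT ntT.
  apply: leq_trans ((moves_EdgeHitter ntT).2 v lv) _.
  have RE : #|R| = #|R :\ v|.+1 by rewrite (cardsD1 v) vR.
  rewrite RE mulnS add2n subn1 ltnS.
  apply: (IHn (R :\ v) (v |: T) _ _).2; first by rewrite -RE.
  apply: transversalS tRT; apply/subsetP => x; rewrite !inE.
  by case: (x == v); rewrite ?orbT.
split; first exact: EdgeHitter_le.
have [tS|ntS] := boolP (transversal S); first by rewrite moves_end.
have [v vR _] := completion_legal tRS ntS.
(* [R] is nonempty, so the subtraction in Edge-hitter's bound is not truncated. *)
have R0 : 0 < 2 * #|R| by rewrite muln_gt0 (cardD1 v) vR.
have [[w _ ->] _] := moves_Staller ntS.
rewrite -(subnK R0) addn1 ltnS; apply: EdgeHitter_le.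
by apply: transversalS tRS; rewrite setUS // subsetUr.
Qed.

(* The subtraction is truncated, which matters only when [tau H = 0], that is,
   when [H] has no edges and no vertex is ever chosen. *)
Theorem mainTheorem4 (H : hypergraph) :
  (tau H <= tau_g H /\ tau_g H <= 2 * tau H - 1) /\
  (tau H <= tau_g' H /\ tau_g' H <= 2 * tau H).
Proof.
have lower p : tau H <= moves p (@set0 (vertex H)).
  by have := tau_le_card_moves H p set0; rewrite cards0.
have [R tR RE] := tau_attained H.
have [|EdgeHitter_le Staller_le] := @moves_le_double H R set0.
  by rewrite setU0.
by rewrite RE in EdgeHitter_le Staller_le; rewrite /tau_g /tau_g'; split; split.
Qed.
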